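(* Let $n\ge1$ and let $q^{n-1},q^n,q^{n+1}$ be (scalar or vector) grid functions. Then $$\tau\,(D_{2\tau}q^{n+1},q^{n+1})_h=\mathcal G(q^{n+1},q^n)-\mathcal G(q^n,q^{n-1})+\tfrac14\|\delta^2q^{n+1}\|_h^2 .$$ If the $q^n$ are scalar-valued (cell-centered), then $$\left(\chi(q^{\dagger,n+1},q^{\dagger,n})-q^{*,n+1},\ \tau D_{2\tau}q^{n+1}\right)_h=(F(q^{\dagger,n+1})-F(q^{\dagger,n}),1)_h+\tfrac38\left(\|q^{n+1}-q^n\|_h^2-\|q^n-q^{n-1}\|_h^2\right)+\tfrac34\|\delta^2q^{n+1}\|_h^2 .$$
   Context: Scalar grid functions are real functions on the $N_x\times N_y$ cell centers of a uniform rectangular grid with mesh sizes $h_x,h_y$, with $(\varphi,\psi)_h=h_xh_y\sum_{i,j}\varphi_{i+1/2,j+1/2}\psi_{i+1/2,j+1/2}$. Vector grid functions $\mathbf u=(u_1,u_2)$ have $u_1$ defined on interior $x$-faces $(i,j+\frac12)$, $1\le i<N_x$, $0\le j<N_y$, and $u_2$ on interior $y$-faces $(i+\frac12,j)$, $0\le i<N_x$, $1\le j<N_y$, with $(\mathbf u,\mathbf v)_h=h_xh_y\sum u_1v_1+h_xh_y\sum u_2v_2$. $\|\cdot\|_h$ is the induced norm. With time step $\tau>0$: $D_{2\tau}q^{n+1}=\frac{3q^{n+1}-4q^n+q^{n-1}}{2\tau}$, $\delta^2q^{n+1}=q^{n+1}-2q^n+q^{n-1}$, $q^{*,n+1}=2q^n-q^{n-1}$,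 $q^{\dagger,n+1}=\frac{3q^{n+1}-q^n}{2}$, $q^{\dagger,n}=\frac{3q^n-q^{n-1}}{2}$. $\mathcal G(a,b)=\frac14(\|a\|_h^2+\|2a-b\|_h^2)$, $F(s)=\frac14(s^2-1)^2$, $\chi(a,b)=\frac14(a^2+b^2)(a+b)$; $F$ and $\chi$ act pointwise. *)

(* Defs.v *)
From HB Require Import structures.
From mathcomp Require Import all_boot all_order all_algebra.
From mathcomp Require Import reals.

Set Implicit Arguments.
Unset Strict Implicit.
Unset Printing Implicit Defensive.

Import Order.TTheory GRing.Theory Num.Theory.
Local Open Scope ring_scope.

(* The (i, j) entry is the value at the cell center (i + 1/2, j + 1/2). *)
Notation scalar_gf R Nx Ny := 'M[R]_(Nx, Ny).

(* Only interior faces carry values: the (i, j) entry of the first component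
   is the value at the x-face (i + 1, j + 1/2), and the (i, j) entry of the
   second component is the value at the y-face (i + 1/2, j + 1). *)
Notation vector_gf R Nx Ny := ('M[R]_(Nx.-1, Ny) * 'M[R]_(Nx, Ny.-1))%type.

Definition sdot (R : realType) (Nx Ny : nat) (hx hy : R)
    (phi psi : scalar_gf R Nx Ny) : R :=
  hx * hy * \sum_(i < Nx) \sum_(j < Ny) phi i j * psi i j.

Definition vdot (R : realType) (Nx Ny : nat) (hx hy : R)
    (u v : vector_gf R Nx Ny) : R :=
  hx * hy * (\sum_(i < Nx.-1) \sum_(j < Ny) u.1 i j * v.1 i j)
  + hx * hy * (\sum_(i < Nx) \sum_(j < Ny.-1) u.2 i j * v.2 i j).

Section InducedNorm.
Context {R : realType} {V : lmodType R}.
Variable dot : V -> V -> R.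

Definition dnorm (u : V) : R := Num.sqrt (dot u u).

Definition calG (a b : V) : R :=
  4^-1 * (dnorm a ^+ 2 + dnorm (2 *: a - b) ^+ 2).
End InducedNorm.

(* In the operators below, m is the time level written as a superscript on q
   (D_{2 tau} q^m, delta^2 q^m, ...). The predecessors are truncated, so the
   three-level operators are meaningful only for m >= 2, and dagger only for
   m >= 1. *)
Section TimeOperators.
Context {R : realType} {V : lmodType R}.
Implicit Type q : nat -> V.

Definition D2 (tau : R) q (m : nat) : V :=
  (2 * tau)^-1 *: (3 *: q m - 4 *: q m.-1 + q m.-2).

Definition delta2 q (m : nat) : V := q m - 2 *: q m.-1 + q m.-2.

Definition star q (m : nat) : V := 2 *: q m.-1 - q m.-2.

Definition dagger q (m : nat) : V := 2^-1 *: (3 *: q m - q m.-1).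
End TimeOperators.

Definition F (R : realType) (s : R) : R := 4^-1 * (s ^+ 2 - 1) ^+ 2.

Definition chi (R : realType) (a b : R) : R :=
  4^-1 * (a ^+ 2 + b ^+ 2) * (a + b).

(* Main.v *)
Require Import Defs.
From HB Require Import structures.
From mathcomp Require Import all_boot all_order all_algebra.
From mathcomp Require Import reals ring.

Set Implicit Arguments.
Unset Strict Implicit.
Unset Printing Implicit Defensive.

Import Order.TTheory GRing.Theory Num.Theory.
Local Open Scope ring_scope.

(** Both identities are polarization identities for a symmetric nonnegative bilinear form, so they
    are proved once for an abstract [dot], which is then instantiated by the grid products. The
    first is 2(3a - 4b + c, a) = |a|^2 + |2a - b|^2 - |b|^2 - |2b - c|^2 + |a - 2b + c|^2
    ([D2_energy]). For the second, [sdot_chi_dagger] trades [chi] for the increment of [F] plus the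
    mean of the two daggers. That mean minus [star] is a multiple of [delta2], and
    [midpoint_star_D2] evaluates what is left. *)

Section InnerProduct.
Context {R : realType} {V : lmodType R}.
Variable dot : V -> V -> R.
Hypothesis dotC : commutative dot.
Hypothesis dot_linear : forall w, scalar (dot^~ w).
Hypothesis dot_ge0 : forall u, 0 <= dot u u.

(** [Num.sqrt] is 0 on negative reals, so nonnegativity of [dot] is essential here. *)
Lemma dnorm_sqr u : dnorm dot u ^+ 2 = dot u u.
Proof. by rewrite /dnorm sqr_sqrtr. Qed.

Lemma dotDl u v w : dot (u + v) w = dot u w + dot v w.
Proof. by rewrite -[u in LHS]scale1r dot_linear mul1r. Qed.

Lemma dotZl a u w : dot (a *: u) w = a * dot u w.
Proof.
have dot0 : dot 0 w = 0 by apply: (addrI (dot 0 w)); rewrite -dotDl !addr0.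
by rewrite -[a *: u]addr0 dot_linear dot0 addr0.
Qed.

Lemma dotNl u w : dot (- u) w = - dot u w.
Proof. by rewrite -scaleN1r dotZl mulN1r. Qed.

Lemma dotDr u v w : dot u (v + w) = dot u v + dot u w.
Proof. by rewrite dotC dotDl !(dotC _ u). Qed.

Lemma dotZr a u w : dot u (a *: w) = a * dot u w.
Proof. by rewrite dotC dotZl (dotC w). Qed.

Lemma dotNr u w : dot u (- w) = - dot u w.
Proof. by rewrite dotC dotNl (dotC w). Qed.

Let dotE := (dnorm_sqr, dotDl, dotDr, dotZl, dotZr, dotNl, dotNr).

Lemma D2_energy (tau : R) (q : nat -> V) n : tau != 0 ->
  tau * dot (D2 tau q n.+1) (q n.+1) =
    calG dot (q n.+1) (q n) - calG dot (q n) (q n.-1)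
    + 4^-1 * dnorm dot (delta2 q n.+1) ^+ 2.
Proof.
move=> tau_neq0; rewrite /D2 /calG /delta2 /= !dotE.
(* Orient the three mixed products, so that [field] sees six independent atoms. *)
rewrite (dotC (q n) (q n.+1)) (dotC (q n.-1) (q n.+1)) (dotC (q n.-1) (q n)).
by field.
Qed.

(** Put d1 = q^{n+1} - q^n and d0 = q^n - q^{n-1}. The left factor is 3/4 (d1 - d0), with d1 - d0 =
    [delta2], and the right one is (3 d1 - d0)/2. Since 3 d1 - d0 = (d1 + d0) + 2 (d1 - d0), the
    product splits into a difference of squares and a multiple of the square of [delta2]. *)
Lemma midpoint_star_D2 (tau : R) (q : nat -> V) n : tau != 0 ->
  dot (2^-1 *: (dagger q n.+1 + dagger q n) - star q n.+1)
      (tau *: D2 tau q n.+1) =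
    3 / 8 * (dnorm dot (q n.+1 - q n) ^+ 2 - dnorm dot (q n - q n.-1) ^+ 2)
    + 3 / 4 * dnorm dot (delta2 q n.+1) ^+ 2.
Proof.
move=> tau_neq0; rewrite /D2 /dagger /star /delta2 /= !dotE.
rewrite (dotC (q n) (q n.+1)) (dotC (q n.-1) (q n.+1)) (dotC (q n.-1) (q n)).
by field.
Qed.
End InnerProduct.

Section GridInnerProducts.
Context {R : realType}.
Variables (Nx Ny : nat) (hx hy : R).
Hypotheses (hx_ge0 : 0 <= hx) (hy_ge0 : 0 <= hy).

(** The dimensions [m] and [n] are free here and below, because the two components of a vector grid
    function are matrices of other shapes than [Nx] by [Ny]. *)
Lemma sdotC m n : commutative (@sdot R m n hx hy).
Proof.
by move=> u v; congr (_ * _); do 2![apply: eq_bigr => ? _]; rewrite mulrC.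
Qed.

Lemma sdot_linear m n w : scalar ((@sdot R m n hx hy)^~ w).
Proof.
move=> a u v; rewrite /sdot mulrCA -mulrDr; congr (_ * _).
rewrite mulr_sumr -big_split; apply: eq_bigr => i _ /=.
rewrite mulr_sumr -big_split; apply: eq_bigr => j _ /=.
by rewrite !mxE mulrDl mulrA.
Qed.

Lemma sdot_ge0 m n u : 0 <= @sdot R m n hx hy u u.
Proof.
rewrite !mulr_ge0 //; do 2![apply: sumr_ge0 => ? _]; exact: sqr_ge0.
Qed.

Lemma vdot_sdot u v :
  @vdot R Nx Ny hx hy u v = sdot hx hy u.1 v.1 + sdot hx hy u.2 v.2.
Proof. by []. Qed.

Lemma vdotC : commutative (@vdot R Nx Ny hx hy).
Proof. by move=> u v; rewrite !vdot_sdot !(sdotC v.1) !(sdotC v.2). Qed.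

Lemma vdot_linear w : scalar ((@vdot R Nx Ny hx hy)^~ w).
Proof. by move=> a u v; rewrite !vdot_sdot !sdot_linear mulrDr addrACA. Qed.

Lemma vdot_ge0 u : 0 <= @vdot R Nx Ny hx hy u u.
Proof. by rewrite vdot_sdot addr_ge0 ?sdot_ge0. Qed.

(* [chi a b * (a - b) = (a ^+ 4 - b ^+ 4) / 4], which differs from
   [F a - F b] exactly by [(a ^+ 2 - b ^+ 2) / 2]; and the two daggers
   differ by [tau *: D2]. *)
Lemma sdot_chi_dagger (tau : R) (q : nat -> scalar_gf R Nx Ny) n :
  tau != 0 ->
  sdot hx hy (map2_mx (@chi R) (dagger q n.+1) (dagger q n))
       (tau *: D2 tau q n.+1) =
    sdot hx hy (map_mx (@F R) (dagger q n.+1) - map_mx (@F R) (dagger q n))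
         (const_mx 1)
    + sdot hx hy (2^-1 *: (dagger q n.+1 + dagger q n))
           (tau *: D2 tau q n.+1).
Proof.
move=> tau_neq0; rewrite /sdot -mulrDr -big_split; congr (_ * _).
apply: eq_bigr => i _ /=; rewrite -big_split; apply: eq_bigr => j _ /=.
rewrite !mxE /chi /F; by field.
Qed.
End GridInnerProducts.

Theorem lemma2p6 (R : realType) (Nx Ny : nat) (hx hy tau : R)
    (Nx_gt0 : (0 < Nx)%N) (Ny_gt0 : (0 < Ny)%N)
    (hx_gt0 : 0 < hx) (hy_gt0 : 0 < hy) (tau_gt0 : 0 < tau)
    (n : nat) (n_ge1 : (1 <= n)%N) :
  let sip := @sdot R Nx Ny hx hy in
  let vip := @vdot R Nx Ny hx hy in
  [/\ forall q : nat -> scalar_gf R Nx Ny,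
        tau * sip (D2 tau q n.+1) (q n.+1) =
          calG sip (q n.+1) (q n) - calG sip (q n) (q n.-1)
          + 4^-1 * dnorm sip (delta2 q n.+1) ^+ 2,
      forall q : nat -> vector_gf R Nx Ny,
        tau * vip (D2 tau q n.+1) (q n.+1) =
          calG vip (q n.+1) (q n) - calG vip (q n) (q n.-1)
          + 4^-1 * dnorm vip (delta2 q n.+1) ^+ 2
    & forall q : nat -> scalar_gf R Nx Ny,
        sip (map2_mx (@chi R) (dagger q n.+1) (dagger q n) - star q n.+1)
            (tau *: D2 tau q n.+1) =
          sip (map_mx (@F R) (dagger q n.+1) - map_mx (@F R) (dagger q n))
              (const_mx 1)
          + 3 / 8 * (dnorm sip (q n.+1 - q n) ^+ 2
                     - dnorm sip (q n - q n.-1) ^+ 2)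
          + 3 / 4 * dnorm sip (delta2 q n.+1) ^+ 2].
Proof.
have tau_neq0 : tau != 0 by rewrite gt_eqF.
have [hx_ge0 hy_ge0] := (ltW hx_gt0, ltW hy_gt0).
move=> sip vip.
have sC : commutative sip by exact: sdotC.
have sP w : scalar (sip^~ w) by exact: sdot_linear.
have s_ge0 u : 0 <= sip u u by exact: sdot_ge0.
split=> q.
- exact: D2_energy.
- apply: D2_energy tau_neq0; [exact: vdotC | exact: vdot_linear | exact: vdot_ge0].
- rewrite (dotDl sP) [sip (map2_mx _ _ _) _]sdot_chi_dagger // -/sip.
  (* Set the [F] term aside and merge the mean of the daggers with [star] again, to reach the left
     side of [midpoint_star_D2]. *)
  rewrite -[LHS]addrA -(dotDl sP).
  by rewrite midpoint_star_D2 // addrA.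
Qed.
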